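(* Let $X_1,\dots,X_n$ be independent and identically distributed real random variables with distribution function $F$, let $X_{n:n}=\max(X_1,\dots,X_n)$, and let $t$ be such that $F(t)>0$. Let $Y_i^{(n,t)}=(X_i\mid X_{n:n}\le t)$, $i=1,\dots,n$. Then $Y_1^{(n,t)},\dots,Y_n^{(n,t)}$ are independent and identically distributed, and $Y_1^{(n,t)}\overset{d}{=}(X_1\mid X_1\le t)$.
   Context: $F(x)=P\{X_1\le x\}$. The conditional random variables $(X_1\mid A),\dots,(X_n\mid A)$, for an event $A$ with $P(A)>0$, are random variables whose joint law is the conditional law of $(X_1,\dots,X_n)$ given $A$, i.e. with joint distribution function $P\{X_1\le x_1,\dots,X_n\le x_n\mid A\}$. $\overset{d}{=}$ denotes equality in distribution. *)

(* Defs.v *)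
From HB Require Import structures.
From mathcomp Require Import all_boot all_order all_algebra.
From mathcomp Require Import all_classical all_reals all_analysis.

Set Implicit Arguments.
Unset Strict Implicit.
Unset Printing Implicit Defensive.

Import Order.TTheory GRing.Theory Num.Theory.

Local Open Scope classical_set_scope.
Local Open Scope ring_scope.

Definition independent_rvs (d : measure_display) (T : measurableType d)
    (R : realType) (P : probability T R) (I : finType)
    (X : I -> {RV P >-> R}) : Prop :=
  forall (J : {set I}) (B : I -> set R), (forall i, measurable (B i)) ->
    P [set w | forall i, i \in J -> B i (X i w)] =
    (\prod_(i in J) P (X i @^-1` B i))%E.

(* Laws are compared on Borel sets only: the library's [distribution] is a
   total function whose values outside the sigma-algebra are meaningless. *)
Definition eq_in_distribution (d1 d2 : measure_display)
    (T1 : measurableType d1) (T2 : measurableType d2) (R : realType)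
    (P1 : probability T1 R) (P2 : probability T2 R)
    (X1 : {RV P1 >-> R}) (X2 : {RV P2 >-> R}) : Prop :=
  forall B : set R, measurable B -> distribution P1 X1 B = distribution P2 X2 B.

Definition identically_distributed (d : measure_display)
    (T : measurableType d) (R : realType) (P : probability T R) (I : finType)
    (X : I -> {RV P >-> R}) : Prop :=
  forall i j : I, eq_in_distribution (X i) (X j).

Definition iid (d : measure_display) (T : measurableType d) (R : realType)
    (P : probability T R) (I : finType) (X : I -> {RV P >-> R}) : Prop :=
  independent_rvs X /\ identically_distributed X.

(* Starting the fold at [X ord0] only avoids the lack of a least element in
   [R]; it is one of the terms of the maximum. *)
Definition rv_max (d : measure_display) (T : measurableType d) (R : realType)
    (P : probability T R) (n : nat) (X : 'I_n.+1 -> {RV P >-> R}) (w : T) : R :=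
  \big[Num.max/X ord0 w]_(i < n.+1) X i w.

Definition cond_prob (d : measure_display) (T : measurableType d)
    (R : realType) (P : probability T R) (B A : set T) : R :=
  fine (P (B `&` A)) / fine (P A).

(* [cond_rvs X A Y]: the family [Y], possibly living on another probability
   space, is a version of [((X i | A))_i], i.e. its joint distribution function
   is the conditional joint distribution function of [X] given [A].  Meaningful
   for measurable [A] with [0 < P A], see [cond_rvs_exist]. *)
Definition cond_rvs (d d' : measure_display) (T : measurableType d)
    (T' : measurableType d') (R : realType) (P : probability T R)
    (Q : probability T' R) (I : finType) (X : I -> {RV P >-> R}) (A : set T)
    (Y : I -> {RV Q >-> R}) : Prop :=
  forall x : I -> R,
    Q [set w | forall i, Y i w <= x i] =
    (cond_prob P [set w | forall i, X i w <= x i] A)%:E.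

Definition cond_rv (d d' : measure_display) (T : measurableType d)
    (T' : measurableType d') (R : realType) (P : probability T R)
    (Q : probability T' R) (X : {RV P >-> R}) (A : set T)
    (Y : {RV Q >-> R}) : Prop :=
  cond_rvs (fun _ : 'I_1 => X) A (fun _ : 'I_1 => Y).

Lemma cond_rvs_exist (d : measure_display) (T : measurableType d)
    (R : realType) (P : probability T R) (I : finType)
    (X : I -> {RV P >-> R}) (A : set T) :
  measurable A -> (0 < P A)%E ->
  exists (Q : probability T R) (Y : I -> {RV Q >-> R}), cond_rvs X A Y.
Proof.
move=> mA PA0.
exists (mnormalize (mrestr P mA) P), X => x.
have PAfin : P A \is a fin_num by exact: fin_num_measure.
have /negPf PAoo : P A != +oo%E by apply: contraTneq PAfin => ->.
set B := [set w | _].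
have mB : measurable B.
  rewrite (_ : B = \bigcap_(i in [set: I]) X i @^-1` `]-oo, x i]).
    apply: fin_bigcap_measurable => // i _; exact: measurable_funPTI.
  apply/seteqP; split => w /= Bw i; first by rewrite /= in_itv; move=> _; apply: Bw.
  by have := Bw i Logic.I; rewrite /= in_itv.
rewrite /= /mnormalize /= /mrestr setTI (gt_eqF PA0) PAoo /= /cond_prob.
by rewrite EFinM fineK // fin_num_measure//; exact: measurableI.
Qed.

(* Main.v *)
Require Import Defs.
From mathcomp Require Import all_boot all_order all_algebra.
From mathcomp Require Import all_classical all_reals all_analysis.
From mathcomp Require Import measurable_realfun.

(** The maximum is at most [t] exactly when every [X i] is, so conditioning on
    it cuts each coordinate at [t] separately.  By independence the conditional
    joint distribution function at [x] is then
      [(\prod_i F (min (x i) t)) / F t ^ (n + 1)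
         = \prod_i (F (min (x i) t) / F t)],
    and [y |-> F (min y t) / F t] is the distribution function of
    [(X ord0 | X ord0 <= t)]: this is [cond_joint_cdf].

    It remains to pass from distribution functions to laws.  A random vector
    whose joint distribution function is a product of one-dimensional ones has
    a product law ([joint_law_of_joint_cdf]): the half-lines [`]-oo, x]] are
    stable under intersection and generate the Borel sets, so they can be
    replaced by arbitrary Borel sets one coordinate at a time.  Finally, a
    vector whose law is a power of [mu] has independent coordinates of law [mu]
    ([iid_of_joint_law]).

    The whole argument takes an arbitrary version [Z] of
    [(X ord0 | X ord0 <= t)] as reference law.  It therefore gives the equality
    in distribution for every [Z], and, since [F t > 0] ensures that some [Z]
    exists, it also gives that the [Y i] are independent and identically
    distributed. *)

Import Order.TTheory GRing.Theory Num.Theory.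
Local Open Scope classical_set_scope.
Local Open Scope ring_scope.

Lemma borel_generated_by_rays (R : realType) :
  @measurable _ R = <<s [set A : set R | exists x, A = `]-oo, x]%classic] >>.
Proof.
apply/seteqP; split; last first.
  apply: smallest_sub; first exact: sigma_algebra_measurable.
  by move=> _ [x ->]; exact: measurable_itv.
rewrite [X in X `<=` _]RGenOInfty.measurableE.
apply: smallest_sub; first exact: smallest_sigma_algebra.
move=> _ [x ->]; rewrite -setCitvl -setTD.
case: (smallest_sigma_algebra [set: R]
  [set A : set R | exists x, A = `]-oo, x]%classic]) => _ + _; apply.
by apply: sub_gen_smallest; exists x.
Qed.

Lemma measure_unique_rays (R : realType)
    (m1 m2 : {measure set R -> \bar R}) :
  (forall x : R, m1 `]-oo, x]%classic = m2 `]-oo, x]%classic) ->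
  (forall x : R, (m1 `]-oo, x]%classic < +oo)%E) ->
  forall B, measurable B -> m1 B = m2 B.
Proof.
move=> m12 m1fin; apply: (@measure_unique _ _ R
  [set A | exists x, A = `]-oo, x]%classic]
  (fun k : nat => `]-oo, k%:R]%classic)) => //.
- exact: borel_generated_by_rays.
- move=> _ _ [x ->] [y ->]; exists (Num.min x y).
  by apply/seteqP; split => z /=; rewrite !in_itv/= le_min => /andP.
- by move=> k; exists k%:R.
- apply/seteqP; split => // z _; exists (Num.trunc `|z|).+1 => //=.
  rewrite in_itv/= (le_trans (ler_norm z))// ltW//.
  exact: truncnS_gt.
- by move=> _ [x ->]; exact: m12.
Qed.

Lemma measurable_joint d (T : measurableType d) (R : realType)
    (P : probability T R) (I : finType) (X : I -> {RV P >-> R})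
    (J : set I) (B : I -> set R) :
  (forall i, measurable (B i)) ->
  measurable [set w | forall i, J i -> B i (X i w)].
Proof.
move=> mB.
rewrite (_ : [set w | _] = \bigcap_(i in J) (X i @^-1` B i)); last by [].
by apply: fin_bigcap_measurable => // i _; exact: measurable_funPTI.
Qed.

(** The product formula is extended from half-lines to Borel sets one
    coordinate at a time: with all the other sets fixed, both sides are finite
    measures in the remaining set, and they agree on half-lines. *)
Lemma joint_law_of_joint_cdf d (T : measurableType d) (R : realType)
    (P : probability T R) (I : finType) (X : I -> {RV P >-> R})
    (mu : I -> probability R R) :
  (forall x : I -> R, P [set w | forall i, X i w <= x i] =
    (\prod_i mu i `]-oo, x i]%classic)%E) ->
  forall B : I -> set R, (forall i, measurable (B i)) ->
    P [set w | forall i, B i (X i w)] = (\prod_i mu i (B i))%E.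
Proof.
move=> cdfP.
(* [s] lists the coordinates whose set is already arbitrary *)
suff main (s : seq I) (B : I -> set R) : (forall i, measurable (B i)) ->
    (forall i, i \notin s -> exists x, B i = `]-oo, x]%classic) ->
    P [set w | forall i, B i (X i w)] = (\prod_i mu i (B i))%E.
  by move=> B mB; apply: (main (enum I)) => // i; rewrite mem_enum.
elim: s B => [|a s IH] B mB rayB.
  have /choice[x Bx] i : exists x, B i = `]-oo, x]%classic by exact: rayB.
  under eq_bigr do rewrite Bx.
  rewrite -cdfP; congr (P _); apply/seteqP.
  by split=> w /= + i => /(_ i); rewrite Bx/= in_itv.
pose C := [set w | forall i, i != a -> B i (X i w)].
have mC : measurable C by exact: measurable_joint.
pose c := (\prod_(i | i != a) mu i (B i))%E.
have cfin : c \is a fin_num.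
  by apply: prode_fin_num => i _; apply: fin_num_measure; exact: mB.
have c0 : 0 <= fine c by apply/fine_ge0/prode_ge0.
have [m1 m1E] : exists m1 : {measure set R -> \bar R},
    forall A, m1 A = P (X a @^-1` A `&` C).
  unshelve eexists (pushforward (mrestr P mC) (X a)); last by [].
  exact: (measurable_funPT (X a)).
pose m2 : {measure set R -> \bar R} := mscale (NngNum c0) (mu a).
pose U A i := if i == a then A else B i.
have m1UE A : m1 A = P [set w | forall i, U A i (X i w)].
  rewrite m1E; congr (P _); apply/seteqP; split.
    by move=> w [/= Aw Cw] i; rewrite /U; case: eqVneq => [->//|/Cw].
  move=> w Uw; split; first by have := Uw a; rewrite /U eqxx.
  by move=> i /negPf ia; have := Uw i; rewrite /U ia.
have m2UE A : m2 A = (\prod_i mu i (U A i))%E.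
  rewrite /m2 /= /mscale /= fineK// (bigD1 a)//= muleC /U eqxx.
  by congr (_ * _)%E; apply: eq_bigr => i /negPf ->.
have UB : U (B a) = B.
  by apply/funext => i; rewrite /U; case: eqVneq => // ->.
rewrite -{1}UB -[in RHS]UB -m1UE -m2UE.
apply: measure_unique_rays (mB a) => x; last first.
  rewrite m1E; apply: (@le_lt_trans _ _ 1%E); last exact: ltry.
  by apply: probability_le1; apply: measurableI => //; exact: measurable_funPTI.
rewrite m1UE m2UE; apply: IH => [i|i si]; rewrite /U; case: eqVneq => // ia.
  by exists x.
by apply: rayB; rewrite in_cons negb_or ia.
Qed.

(** Leaving a coordinate unconstrained contributes the factor [mu setT = 1], so
    the joint law over all coordinates determines that of every subfamily; the
    one-element subfamilies give the marginals. *)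
Lemma iid_of_joint_law d (T : measurableType d) (R : realType)
    (P : probability T R) (I : finType) (X : I -> {RV P >-> R})
    (mu : probability R R) :
  (forall B : I -> set R, (forall i, measurable (B i)) ->
    P [set w | forall i, B i (X i w)] = (\prod_i mu (B i))%E) ->
  iid X /\ forall i B, measurable B -> distribution P (X i) B = mu B.
Proof.
move=> law.
have sublaw (J : {set I}) (B : I -> set R) : (forall i, measurable (B i)) ->
    P [set w | forall i, i \in J -> B i (X i w)] = (\prod_(i in J) mu (B i))%E.
  move=> mB; pose U i := if i \in J then B i else setT.
  rewrite (_ : [set w | _] = [set w | forall i, U i (X i w)]); last first.
    apply/seteqP; split => w /= Xw i.
      by rewrite /U; case: ifPn => // /Xw.
    by move=> iJ; have := Xw i; rewrite /U iJ.
  rewrite law; last by move=> i; rewrite /U; case: ifP.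
  rewrite [RHS]big_mkcond; apply: eq_bigr => i _.
  by rewrite /U; case: ifP => // _; exact: probability_setT.
have marg i B : measurable B -> distribution P (X i) B = mu B.
  move=> mB; have := sublaw [set i]%SET (fun=> B) (fun=> mB).
  rewrite big_set1 => <-; congr (P _).
  by apply/seteqP; split => w /=; [move=> ? j /set1P ->|apply; rewrite inE].
split => //; split; last by move=> i j B mB; rewrite !marg.
by move=> J B mB; rewrite sublaw//; apply: eq_bigr => i _; rewrite -(marg i).
Qed.

Lemma rv_max_le d (T : measurableType d) (R : realType)
    (P : probability T R) n (X : 'I_n.+1 -> {RV P >-> R}) (t : R) :
  [set w | rv_max X w <= t] = [set w | forall i, X i w <= t].
Proof.
apply/seteqP; split => w /=; rewrite /rv_max.
  by move=> + i; apply: le_trans; exact: le_bigmax.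
by move=> Xt; apply: bigmax_le.
Qed.

Lemma iid_joint_cdf d (T : measurableType d) (R : realType)
    (P : probability T R) (I : finType) (X : I -> {RV P >-> R}) (i0 : I)
    (x : I -> R) :
  iid X ->
  P [set w | forall i, X i w <= x i] = (\prod_i cdf (X i0) (x i))%E.
Proof.
move=> [indX idX].
have ray y : measurable (`]-oo, y]%classic : set R) by exact: measurable_itv.
have := indX [set: I]%SET _ (fun i => ray (x i)).
rewrite (_ : [set w | _] = [set w | forall i, X i w <= x i]); last first.
  apply/seteqP; split => w /= Xw i; last by rewrite in_itv/= Xw.
  by have := Xw i (finset.in_setT i); rewrite in_itv.
move=> ->; apply: eq_big => [i|i _]; first by rewrite inE.
exact: (idX i i0 _ (ray (x i))).
Qed.

Lemma cond_rv_cdf d (T : measurableType d) (R : realType)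
    (P : probability T R) (X : {RV P >-> R}) (t : R)
    d' (T' : measurableType d') (Q : probability T' R) (Z : {RV Q >-> R}) :
  cond_rv X [set w | X w <= t] Z ->
  forall y, cdf Z y = (fine (cdf X (Num.min y t)) / fine (cdf X t))%:E.
Proof.
move=> ZX y; have := ZX (fun=> y).
rewrite /cond_prob (_ : [set w | _] = Z @^-1` `]-oo, y]%classic); last first.
  apply/seteqP; split => w /=; rewrite in_itv/=; last by [].
  by apply; exact: ord0.
rewrite /cdf /distribution /pushforward => ->.
congr (fine (P _) / fine (P _))%:E.
apply/seteqP; split => w /=; rewrite in_itv/= le_min.
  by case=> /(_ ord0) -> ->.
by move=> /andP[].
Qed.

(** The events [X i <= x i] and [X i <= t] merge into [X i <= min (x i) t], so
    numerator and denominator are joint distribution functions of [X], and each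
    of them is a product over the coordinates. *)
Lemma cond_joint_cdf d (T : measurableType d) (R : realType)
    (P : probability T R) (I : finType) (X : I -> {RV P >-> R}) (i0 : I)
    (t : R) d' (T' : measurableType d') (Q : probability T' R)
    (Z : {RV Q >-> R}) :
  iid X -> cond_rv (X i0) [set w | X i0 w <= t] Z ->
  forall x : I -> R,
  (cond_prob P [set w | forall i, X i w <= x i]
    [set w | forall i, X i w <= t])%:E = (\prod_i cdf Z (x i))%E.
Proof.
move=> iidX ZX x.
have cdfZ y : cdf Z y =
    (fine (cdf (X i0) (Num.min y t)) / fine (cdf (X i0) t))%:E.
  exact: cond_rv_cdf.
under eq_bigr do rewrite cdfZ.
rewrite prodEFin big_split/= prodfV.
have fine_prod_cdf (y : I -> R) :
    fine (\prod_i cdf (X i0) (y i))%E = \prod_i fine (cdf (X i0) (y i)).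
  rewrite -[RHS]/(fine (_%:E)) -prodEFin; congr fine; apply: eq_bigr => i _.
  by rewrite fineK// fin_num_measure//; exact: measurable_funPTI.
rewrite -(fine_prod_cdf (fun i => Num.min (x i) t)) -(fine_prod_cdf (fun=> t)).
rewrite -!iid_joint_cdf// /cond_prob; congr (fine (P _) / fine (P _))%:E.
apply/seteqP; split => w /=.
  by case=> Xx Xt i; rewrite le_min Xx Xt.
by move=> Xw; split => i; have := Xw i; rewrite le_min => /andP[].
Qed.

Theorem proposition1 (R : realType)
  (d : measure_display) (T : measurableType d) (P : probability T R)
  (n : nat) (X : 'I_n.+1 -> {RV P >-> R}) (hX : iid X)
  (t : R) (ht : (0 < cdf (X ord0) t)%E)
  (d' : measure_display) (T' : measurableType d') (Q : probability T' R)
  (Y : 'I_n.+1 -> {RV Q >-> R})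
  (hY : cond_rvs X [set w | rv_max X w <= t] Y) :
  iid Y /\
  (forall (d'' : measure_display) (T'' : measurableType d'')
     (Q' : probability T'' R) (Z : {RV Q' >-> R}),
     cond_rv (X ord0) [set w | X ord0 w <= t] Z ->
     eq_in_distribution (Y ord0) Z).
Proof.
have law d'' (T'' : measurableType d'') (Q' : probability T'' R)
    (Z : {RV Q' >-> R}) : cond_rv (X ord0) [set w | X ord0 w <= t] Z ->
    iid Y /\ forall i, eq_in_distribution (Y i) Z.
  move=> ZX; apply: iid_of_joint_law.
  apply: joint_law_of_joint_cdf => x.
  by rewrite hY rv_max_le; exact: cond_joint_cdf.
split; last by move=> ? ? ? ? /law[_].
pose A := [set w | X ord0 w <= t].
have AE : A = X ord0 @^-1` `]-oo, t]%classic.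
  by apply/seteqP; split => w /=; rewrite in_itv.
have mA : measurable A by rewrite AE; exact: measurable_funPTI.
have A0 : (0 < P A)%E by rewrite AE.
have [Q' [Z ZX]] := cond_rvs_exist (fun _ : 'I_1 => X ord0) mA A0.
have Z0 : Z = (fun=> Z ord0) by apply/funext => i; rewrite (ord1 i).
by move: ZX; rewrite Z0 => /law[].
Qed.
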